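(* Let $\Gamma$ be a group with finite generating set $S$ and let $\Gamma_S=(\Gamma,d_S)$. If $\Gamma_S$ has $\beta$-stable intervals for some $\beta\ge 0$, then $\Gamma$ acts properly by cellular isometries on the polyhedral complex $\mathrm{E}(\Gamma_S)$ via $(x,f)\mapsto f\circ L_x^{-1}$, and the first barycentric subdivision of $\mathrm{E}(\Gamma_S)$ is a model for the classifying space $\underline{\mathrm{E}}\Gamma$ for proper actions. If $\Gamma_S$ is $\delta$-hyperbolic for some $\delta\ge0$, then in addition $\mathrm{E}(\Gamma_S)$ is finite dimensional and the action is cocompact.
   Context: $d_S$ is the word metric with respect to the alphabet $S\cup S^{-1}$ (left invariant, integer valued); $L_x(y)=xy$. For a metric space $(X,d)$: $\Delta(X)=\{f\colon X\to\mathbb{R}: f(x)+f(y)\ge d(x,y)\ \forall x,y\}$; $\mathrm{E}(X)$ is the set of pointwise-minimal elements of $\Delta(X)$, with metric $\|f-g\|_\infty$. For $f\colon X\to\mathbb R$, $A(f)$ is the set of unordered pairs $\{x,y\}$ ($x=y$ allowed) with $f(x)+f(y)=d(x,y)$; $\mathscr{A}(X)=\{A(f): f\in\Delta(X),\ \bigcup A(f)=X\}$; for $A\in\mathscr A(X)$, $P(A)=\{g\in\mathrm{E}(X): A\subset A(g)\}$. Under the hypothesis, $\mathrm{E}(\Gamma_S)$ is a locally finite polyhedral complex whose cells are the sets $P(A)$, $A\in\mathscr A(\Gamma_S)$ (each a polytope in a finite-dimensional affine subspace of $\mathbb{R}^\Gamma$), and the first barycentric subdivision consists of the simplices spanned by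 barycenters (averages of the vertex sets) of strictly increasing chains of cells. Interval $I(x,y)=\{v: d(x,v)+d(v,y)=d(x,y)\}$; $\beta$-stable intervals: $d_{\mathrm H}(I(x,y),I(x,y'))\le\beta$ whenever $d(y,y')=1$. $\delta$-hyperbolic: $d(w,x)+d(y,z)\le\max\{d(w,y)+d(x,z),d(x,y)+d(w,z)\}+\delta$ for all $w,x,y,z$. *)

(* Defs.v *)
From mathcomp Require Import all_boot monoid.
From Stdlib Require Import Reals ClassicalEpsilon.

Set Implicit Arguments.
Unset Strict Implicit.
Unset Printing Implicit Defensive.

Local Open Scope R_scope.

Section MetricDefs.
Variables (X : Type) (d : X -> X -> R).

Definition inDelta (f : X -> R) : Prop := forall x y, d x y <= f x + f y.

Definition inEX (f : X -> R) : Prop :=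
  inDelta f /\
  forall g, inDelta g -> (forall x, g x <= f x) -> forall x, g x = f x.

(* A(f), as a (symmetric) relation: {x,y} in A(f) iff f x + f y = d x y *)
Definition Aof (f : X -> R) : X -> X -> Prop := fun x y => f x + f y = d x y.

Definition inscrA (A : X -> X -> Prop) : Prop :=
  exists f, inDelta f /\ (forall x y, A x y <-> Aof f x y) /\
            (forall x, exists y, A x y).

Definition Pcell (A : X -> X -> Prop) : (X -> R) -> Prop :=
  fun g => inEX g /\ forall x y, A x y -> g x + g y = d x y.

Definition is_cell (C : (X -> R) -> Prop) : Prop :=
  exists A, inscrA A /\ forall g, C g <-> Pcell A g.

(* sup-metric ||f - g||_oo, via "<= r" and "< r" *)
Definition dist_le (f g : X -> R) (r : R) : Prop :=
  forall x, Rabs (f x - g x) <= r.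
Definition dist_lt (f g : X -> R) (r : R) : Prop :=
  exists r', r' < r /\ dist_le f g r'.

Definition is_vertex (C : (X -> R) -> Prop) (v : X -> R) : Prop :=
  C v /\ forall g h t, C g -> C h -> 0 < t < 1 ->
    (forall x, v x = t * g x + (1 - t) * h x) -> forall x, g x = v x.

Definition sumR (s : seq R) : R := foldr Rplus 0 s.

Definition is_barycenter (C : (X -> R) -> Prop) (b : X -> R) : Prop :=
  exists vs : seq (X -> R),
    List.NoDup vs /\ vs <> [::] /\
    (forall v, List.In v vs <-> is_vertex C v) /\
    forall x, b x = sumR (map (fun v => v x) vs) / INR (size vs).

Fixpoint strict_chain (cs : seq ((X -> R) -> Prop)) : Prop :=
  match cs with
  | [::] => True
  | C :: cs' =>
      match cs' with
      | [::] => True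
      | C' :: _ => ((forall g, C g -> C' g) /\ exists g, C' g /\ ~ C g)
                   /\ strict_chain cs'
      end
  end.

Definition conv_hull (bs : seq (X -> R)) : (X -> R) -> Prop :=
  fun g => exists ts : seq R,
    size ts = size bs /\ List.Forall (fun t => 0 <= t) ts /\ sumR ts = 1 /\
    forall x, g x = sumR (map (fun p => p.1 * p.2 x) (zip ts bs)).

Definition subdiv_simplex (sigma : (X -> R) -> Prop) : Prop :=
  exists (cs : seq ((X -> R) -> Prop)) (bs : seq (X -> R)),
    cs <> [::] /\ List.Forall is_cell cs /\ strict_chain cs /\
    List.Forall2 is_barycenter cs bs /\
    forall g, sigma g <-> conv_hull bs g.

Definition affdim_le (C : (X -> R) -> Prop) (n : nat) : Prop :=
  exists (p : X -> R) (us : seq (X -> R)), size us = n /\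
    forall g, C g -> exists cs : seq R, size cs = n /\
      forall x, g x = p x + sumR (map (fun q => q.1 * q.2 x) (zip cs us)).

Definition seq_compact (K : (X -> R) -> Prop) : Prop :=
  forall u : nat -> X -> R, (forall n, K (u n)) ->
    exists (phi : nat -> nat) (l : X -> R),
      (forall n, (phi n < phi n.+1)%nat) /\ K l /\
      forall eps, 0 < eps -> exists N, forall n, (N <= n)%nat ->
        dist_le (u (phi n)) l eps.

Definition contractible (C : (X -> R) -> Prop) : Prop :=
  exists (c : X -> R) (h : R -> (X -> R) -> (X -> R)),
    C c /\
    (forall t f, 0 <= t <= 1 -> C f -> C (h t f)) /\
    (forall f, C f -> forall x, h 0 f x = f x) /\
    (forall f, C f -> forall x, h 1 f x = c x) /\
    (forall t f, 0 <= t <= 1 -> C f ->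
       forall eps, 0 < eps -> exists del, 0 < del /\
         forall s g, 0 <= s <= 1 -> C g -> Rabs (s - t) < del ->
           dist_lt f g del -> dist_lt (h t f) (h s g) eps).

Definition intervalX (x y : X) : X -> Prop := fun v => d x v + d v y = d x y.
Definition hausdorff_le (A B : X -> Prop) (b : R) : Prop :=
  (forall a, A a -> exists c, B c /\ d a c <= b) /\
  (forall c, B c -> exists a, A a /\ d c a <= b).
Definition stable_intervals (beta : R) : Prop :=
  forall x y y', d y y' = 1 -> hausdorff_le (intervalX x y) (intervalX x y') beta.

Definition hyperbolic (delta : R) : Prop :=
  forall w x y z, d w x + d y z <= Rmax (d w y + d x z) (d x y + d w z) + delta.

End MetricDefs.

Section GroupDefs.
Local Open Scope group_scope.
Variables (G : groupType) (S : seq G).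

Definition letter (a : G) : bool := (a \in S) || (a^-1 \in S).

Definition word_prod (w : seq G) : G := foldr (fun a b => a * b) 1 w.

Definition generates : Prop :=
  forall x : G, exists w, all letter w /\ word_prod w = x.

Definition reach (n : nat) (x : G) : Prop :=
  exists w, all letter w /\ size w = n /\ word_prod w = x.

Definition wlen (x : G) : nat :=
  epsilon (inhabits 0%nat)
    (fun n => reach n x /\ forall m, reach m x -> (n <= m)%nat).

Definition dS (x y : G) : R := INR (wlen (x^-1 * y)).

Definition act (x : G) (f : G -> R) : G -> R := fun z => f (x^-1 * z).

Definition act_img (x : G) (C : (G -> R) -> Prop) : (G -> R) -> Prop :=
  fun g => exists f, C f /\ forall z, g z = act x f z.

Definition subgroup (H : G -> Prop) : Prop :=
  H 1 /\ forall x y, H x -> H y -> H (x * y^-1).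

Definition finite_set (H : G -> Prop) : Prop :=
  exists l : seq G, forall x, H x -> x \in l.

Definition fixE (H : G -> Prop) : (G -> R) -> Prop :=
  fun f => inEX dS f /\ forall h, H h -> forall z, act h f z = f z.

End GroupDefs.

(* Main.v *)
(** [Delta(X)] retracts onto [E(X)] by iterating f |-> (f + f')/2 with f'(x) = sup_w (d(x,w) - f(w));
    the retraction is 1-Lipschitz and commutes with isometries, so straight-line homotopies
    in [Delta] project to contractions of the fixed point sets [E(X)^H].

    Stable intervals give finitely many cone types. If f in [E] has f(o) <= M, then almost
    tight pairs {z,w} have an interval meeting a fixed ball around o, so f(z) - d(z,o) only
    depends on the type of z, i.e. on d(z,.) - d(z,o) restricted to a fixed ball around o.
    Hence finitely many values determine f, uniformly in f: this bounds the dimension of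
    cells and makes bounded parts of [E] compact. Compact cells have enough vertices for
    A(barycenter of P(A)) = A, so an element preserving a simplex permutes a finite chain of
    sets A monotonically and fixes it. In the hyperbolic case every f in [E] takes a value
    at most delta + 2, so all of this is uniform up to translation. *)
Require Import Defs.
From mathcomp Require Import all_boot monoid zify.
From Stdlib Require Import Reals Lra ClassicalEpsilon FunctionalExtensionality PropExtensionality.
From Stdlib Require Import Sorted Permutation Wf_nat.

Local Open Scope R_scope.

(** * Suprema of bounded sets of reals *)

Definition supR (E : R -> Prop) : R := epsilon (inhabits 0) (is_lub E).

Lemma supR_lub (E : R -> Prop) : (exists r, E r) -> bound E -> is_lub E (supR E).
Proof.
move=> E0 bE; apply: epsilon_spec.
by case: (completeness E bE E0) => m mP; exists m.
Qed.

Lemma Rabs_le_inv x y : Rabs x <= y -> - y <= x <= y.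
Proof. by move=> h; have := Rle_abs x; have := Rle_abs (- x); rewrite Rabs_Ropp; lra. Qed.

(** * Extremal functions and the retraction onto them *)

Section InjectiveHull.
Variables (X : Type) (d : X -> X -> R).
Hypotheses (dxx : forall x, d x x = 0) (dC : forall x y, d x y = d y x)
  (dtri : forall x y z, d x z <= d x y + d y z).

Lemma inDelta_ge0 (f : X -> R) x : inDelta d f -> 0 <= f x.
Proof. by move=> fD; have := fD x x; rewrite dxx; lra. Qed.

(** Otherwise [f] could be lowered at [x] alone. The drop is only [eps / 2], since the pair of [x]
    with itself loses twice the drop. *)
Lemma inEX_tight (f : X -> R) x eps :
  inEX d f -> 0 < eps -> exists w, f x + f w <= d x w + eps.
Proof.
move=> [fD fmin] e0; apply: NNPP => H.
pose g := fun y => if excluded_middle_informative (y = x) then f x - eps / 2 else f y.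
have gx w : d x w + eps < f x + f w.
  by apply: Rnot_le_lt => h; apply: H; exists w.
have gx0 : g x = f x - eps / 2.
  by rewrite /g; case: excluded_middle_informative.
have gE y : (y = x /\ g y = f x - eps / 2) \/ g y = f y.
  by rewrite /g; case: excluded_middle_informative; [left|right].
have gf y : g y <= f y by case: (gE y) => [[-> ->]|->]; lra.
have gD : inDelta d g.
  move=> y z; case: (gE y) (gE z) => [[-> ->]|->] [[-> ->]|->].
  - by have := gx x; rewrite dxx; lra.
  - by have := gx z; lra.
  - by have := gx y; rewrite (dC y x); lra.
  - exact: fD.
by have := fmin g gD gf x; lra.
Qed.

Lemma tight_inEX (f : X -> R) : inDelta d f ->
  (forall x eps, 0 < eps -> exists w, f x + f w <= d x w + eps) -> inEX d f.
Proof.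
move=> fD ft; split=> // g gD gf x; apply: Rle_antisym => //.
apply: le_epsilon => eps e0; have [w hw] := ft x eps e0.
by have := gD x w; have := gf w; lra.
Qed.

Lemma cover_inEX (f : X -> R) : inDelta d f -> (forall x, exists y, f x + f y = d x y) -> inEX d f.
Proof.
move=> fD ft; apply: tight_inEX => // x eps e0.
by have [y hy] := ft x; exists y; lra.
Qed.

Lemma inEX_lip (f : X -> R) x y : inEX d f -> f x <= f y + d x y.
Proof.
move=> fE; apply: le_epsilon => eps e0.
have [w hw] := inEX_tight f x eps fE e0.
by have := dtri x y w; have := proj1 fE y w; lra.
Qed.

(** Combining [d x o <= g x + g o] with the Lipschitz bound gives [f x <= f o + g o + g x], and
    symmetrically. *)
Lemma inEX_dist (f g : X -> R) o : inEX d f -> inEX d g -> dist_le f g (f o + g o).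
Proof.
move=> fE gE x; apply: Rabs_le.
have := inEX_lip f x o fE; have := inEX_lip g x o gE.
by have := proj1 fE x o; have := proj1 gE x o; lra.
Qed.

Lemma inEX_closed (f : X -> R) :
  (forall eps, 0 < eps -> exists g, inEX d g /\ dist_le g f eps) -> inEX d f.
Proof.
move=> fl.
have fD : inDelta d f.
  move=> x y; apply: le_epsilon => eps e0.
  have [g [[gD _] gf]] := fl (eps / 2) ltac:(lra).
  by have := gD x y; move: (gf x) (gf y) => /Rabs_le_inv ? /Rabs_le_inv ?; lra.
apply: tight_inEX => // x eps e0.
have [g [gE gf]] := fl (eps / 3) ltac:(lra).
have [w hw] := inEX_tight g x (eps / 3) gE ltac:(lra).
by exists w; move: (gf x) (gf w) => /Rabs_le_inv ? /Rabs_le_inv ?; lra.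
Qed.

(** For [f] in Delta this is the least [h] with [d x w <= h x + f w] for all [x] and [w]; the
    extremal functions are the [f] in Delta with [conjf f = f]. *)
Definition conjf (f : X -> R) (x : X) : R := supR (fun r => exists w, r = d x w - f w).

Lemma conjf_le f x b : (forall w, d x w - f w <= b) -> conjf f x <= b.
Proof.
move=> h; have [_] : is_lub (fun r => exists w, r = d x w - f w) (conjf f x).
  apply: supR_lub; first by exists (d x x - f x), x.
  by exists b => _ [w ->].
by apply=> _ [w ->].
Qed.

Lemma conjf_ge f x w : inDelta d f -> d x w - f w <= conjf f x.
Proof.
move=> fD; have [h _] : is_lub (fun r => exists w, r = d x w - f w) (conjf f x).
  apply: supR_lub; first by exists (d x x - f x), x.
  by exists (f x) => _ [v ->]; have := fD x v; lra.
by apply: h; exists w.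
Qed.

Lemma conjf_approx f x eps : 0 < eps -> exists w, conjf f x - eps <= d x w - f w.
Proof.
move=> e0; apply: NNPP => H.
suff : conjf f x <= conjf f x - eps by lra.
apply: conjf_le => w; apply: Rnot_lt_le => h; apply: H; exists w; lra.
Qed.

Definition halff (f : X -> R) (x : X) : R := (f x + conjf f x) / 2.

(** Average [d x y <= f x + conjf f y] and [d x y <= conjf f x + f y]. The mean is used because
    [conjf f] alone may leave Delta. *)
Lemma halff_inDelta f : inDelta d f -> inDelta d (halff f).
Proof.
move=> fD x y; rewrite /halff.
by have := conjf_ge f x y fD; have := conjf_ge f y x fD; rewrite (dC y x); lra.
Qed.

Lemma halff_le f x : inDelta d f -> halff f x <= f x.
Proof.
move=> fD; rewrite /halff; suff : conjf f x <= f x by lra.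
by apply: conjf_le => w; have := fD x w; lra.
Qed.

Lemma halff_dist f g r : inDelta d f -> inDelta d g -> dist_le f g r ->
  dist_le (halff f) (halff g) r.
Proof.
move=> fD gD fg x; rewrite /halff.
have h1 : conjf f x <= conjf g x + r.
  by apply: conjf_le => w; have := conjf_ge g x w gD; move: (fg w) => /Rabs_le_inv; lra.
have h2 : conjf g x <= conjf f x + r.
  by apply: conjf_le => w; have := conjf_ge f x w fD; move: (fg w) => /Rabs_le_inv; lra.
by apply: Rabs_le; move: (fg x) => /Rabs_le_inv; lra.
Qed.

Lemma halff_equiv f s : inDelta d f -> (forall x y, d (s x) (s y) = d x y) ->
  (forall y, exists x, s x = y) -> (forall x, f (s x) = f x) ->
  forall x, halff f (s x) = halff f x.
Proof.
move=> fD sd ss sf x; rewrite /halff sf; congr ((_ + _) / _); apply: Rle_antisym.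
  apply: conjf_le => w; have [v <-] := ss w.
  by rewrite sd sf; apply: conjf_ge.
by apply: conjf_le => w; rewrite -sd -(sf w); apply: conjf_ge.
Qed.

(* Iterating [halff] decreases to a fixed point of [conjf], i.e. an extremal function. *)
Definition retr (f : X -> R) (x : X) : R := - supR (fun r => exists n, r = - iter n halff f x).

Lemma iter_inDelta f n : inDelta d f -> inDelta d (iter n halff f).
Proof. by move=> fD; elim: n => //= n IH; apply: halff_inDelta. Qed.

Lemma iter_le f (m n : nat) x : inDelta d f -> (m <= n)%nat -> iter n halff f x <= iter m halff f x.
Proof.
move=> fD /subnK <-; elim: (n - m)%nat => [|k IH] /=; first by rewrite add0n; lra.
by apply: Rle_trans IH; apply: halff_le; apply: iter_inDelta.
Qed.

Lemma retr_lub f x : inDelta d f ->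
  is_lub (fun r => exists n, r = - iter n halff f x) (supR (fun r => exists n, r = - iter n halff f x)).
Proof.
move=> fD; apply: supR_lub; first by exists (- f x), O.
by exists 0 => _ [n ->]; have := inDelta_ge0 _ x (iter_inDelta f n fD); lra.
Qed.

Lemma retr_le f n x : inDelta d f -> retr f x <= iter n halff f x.
Proof.
move=> fD; have [h _] := retr_lub f x fD.
by rewrite /retr; have := h (- iter n halff f x) (ex_intro _ n erefl); lra.
Qed.

Lemma retr_ge f x b : inDelta d f -> (forall n, b <= iter n halff f x) -> b <= retr f x.
Proof.
move=> fD bf; have [_ h] := retr_lub f x fD.
rewrite /retr; suff : supR (fun r => exists n, r = - iter n halff f x) <= - b by lra.
by apply: h => _ [n ->]; have := bf n; lra.
Qed.

Lemma retr_approx f x eps : inDelta d f -> 0 < eps ->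
  exists n, iter n halff f x <= retr f x + eps.
Proof.
move=> fD e0; apply: NNPP => H.
suff : retr f x + eps <= retr f x by lra.
apply: retr_ge => // n; apply: Rnot_lt_le => h; apply: H; exists n; lra.
Qed.

Lemma retr_inDelta f : inDelta d f -> inDelta d (retr f).
Proof.
move=> fD x y; apply: le_epsilon => eps e0.
have [m hm] := retr_approx f x (eps / 2) fD ltac:(lra).
have [n hn] := retr_approx f y (eps / 2) fD ltac:(lra).
have := iter_inDelta f (maxn m n) fD x y.
have := iter_le f m (maxn m n) x fD (leq_maxl m n).
by have := iter_le f n (maxn m n) y fD (leq_maxr m n); lra.
Qed.

Lemma retr_inEX f : inDelta d f -> inEX d (retr f).
Proof.
move=> fD; apply: tight_inEX; first exact: retr_inDelta.
move=> x eps e0.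
have [n hn] := retr_approx f x (eps / 2) fD ltac:(lra).
have [w hw] := conjf_approx (iter n halff f) x (eps / 2) ltac:(lra).
(* The limit lies below the next iterate, the mean of the [n]-th iterate and its conjugate. As the
   [n]-th iterate is close to the limit at [x], its conjugate there is at least
   [retr f x - eps / 2]. *)
exists w; have := retr_le f n.+1 x fD; rewrite /= {1}/halff.
by have := retr_le f n w fD; lra.
Qed.

Lemma retr_id f x : inEX d f -> retr f x = f x.
Proof.
move=> [fD fmin]; apply: fmin; first exact: retr_inDelta.
by move=> y; apply: (retr_le f 0).
Qed.

Lemma retr_dist f g r : inDelta d f -> inDelta d g -> dist_le f g r ->
  dist_le (retr f) (retr g) r.
Proof.
move=> fD gD fg.
have fgn n : dist_le (iter n halff f) (iter n halff g) r.
  by elim: n => //= n IH; apply: halff_dist => //; apply: iter_inDelta.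
move=> x; apply: Rabs_le.
have h1 : retr f x - r <= retr g x.
  by apply: retr_ge => // n; have := retr_le f n x fD; move: (fgn n x) => /Rabs_le_inv; lra.
have h2 : retr g x - r <= retr f x.
  by apply: retr_ge => // n; have := retr_le g n x gD; move: (fgn n x) => /Rabs_le_inv; lra.
lra.
Qed.

Lemma retr_equiv f s : inDelta d f -> (forall x y, d (s x) (s y) = d x y) ->
  (forall y, exists x, s x = y) -> (forall x, f (s x) = f x) ->
  forall x, retr f (s x) = retr f x.
Proof.
move=> fD sd ss sf x.
have sn n y : iter n halff f (s y) = iter n halff f y.
  elim: n y => //= n IH y; apply: halff_equiv => //; exact: iter_inDelta.
apply: Rle_antisym; apply: retr_ge => // n; first by rewrite -sn; apply: retr_le.
by rewrite sn; apply: retr_le.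
Qed.

Lemma inDelta_convex f g t : 0 <= t <= 1 -> inDelta d f -> inDelta d g ->
  inDelta d (fun x => (1 - t) * f x + t * g x).
Proof.
move=> t01 fD gD x y; have := fD x y; have := gD x y; nra.
Qed.

(* The retraction of the straight-line homotopy to [c] contracts any class of extremal
   functions that is stable under it. *)
Lemma contractible_inEX (C : (X -> R) -> Prop) (c : X -> R) : C c ->
  (forall f, C f -> inEX d f) ->
  (forall t f, 0 <= t <= 1 -> C f -> C (retr (fun x => (1 - t) * f x + t * c x))) ->
  inhabited X -> contractible C.
Proof.
move=> Cc CE Ch [o].
exists c, (fun t f => retr (fun x => (1 - t) * f x + t * c x)).
have cE := CE c Cc.
split=> //; split=> //; split; [|split].
- move=> f Cf x; have -> : (fun x0 => (1 - 0) * f x0 + 0 * c x0) = f.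
    by apply: functional_extensionality => y; lra.
  by apply: retr_id; apply: CE.
- move=> f Cf x; have -> : (fun x0 => (1 - 1) * f x0 + 1 * c x0) = c.
    by apply: functional_extensionality => y; lra.
  exact: retr_id.
move=> t f t01 Cf eps e0; have fE := CE f Cf.
have f0 := inDelta_ge0 f o (proj1 fE); have c0 := inDelta_ge0 c o (proj1 cE).
(* [B] exceeds the distance from [f] to [c], so a time change below [eps / (4 * B)] costs at most
   [eps / 4]; by [1 <= B], replacing [f] by [g] costs no more than that. *)
pose B := f o + c o + 1.
have B1 : 1 <= B by rewrite /B; lra.
have dp : 0 < eps / (4 * B) by apply: Rdiv_lt_0_compat; lra.
have dB : eps / (4 * B) * B = eps / 4 by field; lra.
exists (eps / (4 * B)); split=> // s g s01 Cg st [r [rd fg]]; have gE := CE g Cg.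
exists (eps / 2); split; first lra.
have cD := proj1 cE.
apply: retr_dist; [exact: inDelta_convex (proj1 fE) cD|exact: inDelta_convex (proj1 gE) cD|].
move=> x; have := inEX_dist f c o fE cE x; move: (fg x) st.
move=> /Rabs_le_inv h1 /Rabs_def2 h2 /Rabs_le_inv h3; apply: Rabs_le.
have -> : (1 - t) * f x + t * c x - ((1 - s) * g x + s * c x)
   = (1 - s) * (f x - g x) + (s - t) * (f x - c x) by ring.
set e := eps / (4 * B) in dp dB rd h2.
have eB : e <= eps / 4 by nra.
have k1 : - e <= (1 - s) * (f x - g x) <= e by nra.
have k2 : - (e * B) <= (s - t) * (f x - c x) <= e * B.
  apply: Rabs_le_inv; rewrite Rabs_mult.
  apply: Rmult_le_compat; try exact: Rabs_pos; apply: Rabs_le; rewrite /B; lra.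
lra.
Qed.

End InjectiveHull.

(** * Order on naturals and reals, and convergent subsequences *)

Lemma leq_INR (m n : nat) : (m <= n)%nat -> INR m <= INR n.
Proof. by move=> h; apply: le_INR; lia. Qed.

Lemma INR_leq (m n : nat) : INR m <= INR n -> (m <= n)%nat.
Proof. by move=> /INR_le; lia. Qed.

Lemma increasing_ge (phi : nat -> nat) n : (forall k, (phi k < phi k.+1)%nat) -> (n <= phi n)%nat.
Proof. by move=> h; elim: n => // n IH; have := h n; lia. Qed.

Lemma increasing_lt (phi : nat -> nat) (m n : nat) :
  (forall k, (phi k < phi k.+1)%nat) -> (m < n)%nat -> (phi m < phi n)%nat.
Proof.
move=> h; elim: n => // n IH mn; have := h n.
have [/IH|->//] : (m < n)%nat \/ m = n by lia.
lia.
Qed.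

(** Bolzano-Weierstrass yields a cluster point; [phi] recursively picks an index beyond the previous
    one with value within [/ INR n.+1] of it. *)
Lemma bounded_subseq (u : nat -> R) B : (forall n, Rabs (u n) <= B) ->
  exists (phi : nat -> nat) (l : R), (forall n, (phi n < phi n.+1)%nat) /\
    forall eps, 0 < eps -> exists N, forall n, (N <= n)%nat -> Rabs (u (phi n) - l) <= eps.
Proof.
move=> uB.
have [l hl] := Bolzano_Weierstrass u _ (compact_P3 (- B) B) (fun n => Rabs_le_inv _ _ (uB n)).
have pos n : 0 < / INR n.+1 by apply: Rinv_0_lt_compat; apply: lt_0_INR; lia.
have ex n N : exists p, (N <= p)%nat /\ Rabs (u p - l) < / INR n.+1.
  have [p [Np hp]] := hl (disc l (mkposreal _ (pos n))) N
     (ex_intro _ (mkposreal _ (pos n)) (fun x h => h)).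
  by exists p; split=> //; lia.
pose next n N := proj1_sig (constructive_indefinite_description _ (ex n N)).
have nextP n N := proj2_sig (constructive_indefinite_description _ (ex n N)).
pose phi := fix phi n := if n is m.+1 then next m.+1 (phi m).+1 else next O O.
exists phi, l; split; first by move=> n; have [] := nextP n.+1 (phi n).+1.
have phiP n : Rabs (u (phi n) - l) < / INR n.+1.
  by case: n => [|n]; [have [] := nextP O O|have [] := nextP n.+1 (phi n).+1].
move=> eps e0; have [N [hN N0]] := archimed_cor1 eps e0.
exists N => n Nn; have := phiP n.
have : / INR n.+1 <= / INR N.
  by apply: Rinv_le_contravar; [apply: lt_0_INR|apply: leq_INR; lia].
lra.
Qed.

(** * Function sets determined by finitely many values *)

Section FiniteCoordinates.
Variable X : Type.
Implicit Type K : (X -> R) -> Prop.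

Lemma cauchy_subseq (Z : seq X) (u : nat -> X -> R) :
  (forall z, exists B, forall n, Rabs (u n z) <= B) ->
  exists phi : nat -> nat, (forall n, (phi n < phi n.+1)%nat) /\
    forall eps, 0 < eps -> exists N, forall m n, (N <= m)%nat -> (N <= n)%nat ->
      forall z, List.In z Z -> Rabs (u (phi m) z - u (phi n) z) <= eps.
Proof.
move=> uB; elim: Z => [|z Z [phi [phii IH]]].
  by exists (fun n => n); split=> // eps _; exists O.
have [B hB] := uB z.
have [psi [l [psii hl]]] := bounded_subseq (fun n => u (phi n) z) B (fun n => hB _).
exists (phi \o psi); split=> [n|eps e0]; first exact: (increasing_lt phi (psi n) (psi n.+1)).
have [N1 h1] := IH eps e0; have [N2 h2] := hl (eps / 2) ltac:(lra).
exists (maxn N1 N2) => m n Nm Nn y /= [<-|yZ].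
  have := h2 m ltac:(lia); have := h2 n ltac:(lia) => /Rabs_le_inv ? /Rabs_le_inv ?.
  by apply: Rabs_le; lra.
by apply: h1 => //; [have := increasing_ge psi m psii|have := increasing_ge psi n psii]; lia.
Qed.

(** The constants cancel in differences of two members of [K], so sup distances within [K] are read
    off on [Z]. *)
Definition fin_coord K (Z : seq X) : Prop :=
  forall z, exists z' c, List.In z' Z /\ forall f, K f -> f z = f z' + c.

Definition pt_bounded K : Prop := forall z, exists B, forall f, K f -> Rabs (f z) <= B.

Definition unif_closed K : Prop :=
  forall f, (forall eps, 0 < eps -> exists g, K g /\ dist_le g f eps) -> K f.

Lemma fin_coord_seq_compact K Z :
  fin_coord K Z -> pt_bounded K -> unif_closed K -> seq_compact K.
Proof.
move=> KZ KB Kc u uK.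
have [phi [phii uC]] : exists phi : nat -> nat, (forall n, (phi n < phi n.+1)%nat) /\
    forall eps, 0 < eps -> exists N, forall m n, (N <= m)%nat -> (N <= n)%nat ->
      forall z, List.In z Z -> Rabs (u (phi m) z - u (phi n) z) <= eps.
  by apply: cauchy_subseq => z; have [B hB] := KB z; exists B => n; apply: hB.
have {}uC eps : 0 < eps -> exists N, forall m n, (N <= m)%nat -> (N <= n)%nat ->
      forall z, Rabs (u (phi m) z - u (phi n) z) <= eps.
  move=> e0; have [N hN] := uC eps e0; exists N => m n Nm Nn z.
  have [z' [c [z'Z h]]] := KZ z; rewrite !h //.
  have -> : u (phi m) z' + c - (u (phi n) z' + c) = u (phi m) z' - u (phi n) z' by ring.
  exact: hN.
have cv z : exists l, Un_cv (fun n => u (phi n) z) l.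
  have [|l hl] := R_complete (fun n => u (phi n) z); last by exists l.
  move=> eps e0; have [N hN] := uC (eps / 2) ltac:(lra).
  exists N => n m Nn Nm; rewrite /Rdist.
  have := hN n m ltac:(lia) ltac:(lia) z; lra.
pose l z := proj1_sig (constructive_indefinite_description _ (cv z)).
have lP z : Un_cv (fun n => u (phi n) z) (l z) by apply: proj2_sig.
have unif eps : 0 < eps -> exists N, forall n, (N <= n)%nat -> dist_le (u (phi n)) l eps.
  move=> e0; have [N hN] := uC eps e0; exists N => n Nn z.
  apply: le_epsilon => e' e'0; have [M hM] := lP z e' e'0.
  have := hM (maxn M N) ltac:(lia); have := hN n (maxn M N) Nn ltac:(lia) z.
  rewrite /Rdist => /Rabs_le_inv ? /Rabs_def2 ?; apply: Rabs_le; lra.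
exists phi, l; split=> //; split=> //.
apply: Kc => eps e0; have [N hN] := unif eps e0.
by exists (u (phi N)); split=> //; apply: hN.
Qed.

Definition face K a b : (X -> R) -> Prop :=
  fun g => K g /\ forall h, K h -> h a + h b <= g a + g b.

Lemma face_nonempty K a b : seq_compact K -> pt_bounded K -> (exists g, K g) ->
  exists g, face K a b g.
Proof.
move=> Kc KB [g0 Kg0]; pose E r := exists g, K g /\ r = g a + g b.
have [s [sub slub]] : {m | is_lub E m}.
  apply: completeness; last by exists (g0 a + g0 b), g0.
  have [A hA] := KB a; have [B hB] := KB b; exists (A + B) => _ [g [Kg ->]].
  by move: (hA g Kg) (hB g Kg) => /Rabs_le_inv ? /Rabs_le_inv ?; lra.
have pos n : 0 < / INR n.+1 by apply: Rinv_0_lt_compat; apply: lt_0_INR; lia.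
have ex n : exists g, K g /\ s - / INR n.+1 <= g a + g b.
  apply: NNPP => H; suff : s <= s - / INR n.+1 by have := pos n; lra.
  apply: slub => _ [g [Kg ->]]; apply: Rnot_lt_le => h; apply: H; exists g; split=> //; lra.
pose u n := proj1_sig (constructive_indefinite_description _ (ex n)).
have uP n : K (u n) /\ s - / INR n.+1 <= u n a + u n b.
  exact: (proj2_sig (constructive_indefinite_description _ (ex n))).
have [phi [l [phii [Kl hl]]]] := Kc u (fun n => proj1 (uP n)).
exists l; split=> // h Kh; apply: Rle_trans (sub _ (ex_intro _ h (conj Kh erefl))) _.
apply: le_epsilon => eps e0.
have [N hN] := hl (eps / 3) ltac:(lra).
have [M [hM M0]] := archimed_cor1 (eps / 3) ltac:(lra).
have := hN (maxn N M) ltac:(lia); set n := maxn N M => hn.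
have := proj2 (uP (phi n)).
have : / INR (phi n).+1 <= / INR M.
  apply: Rinv_le_contravar; first exact: lt_0_INR.
  by apply: leq_INR; have := increasing_ge phi n phii; lia.
by move: (hn a) (hn b) => /Rabs_le_inv ? /Rabs_le_inv ?; lra.
Qed.

Lemma face_seq_compact K a b : seq_compact K -> seq_compact (face K a b).
Proof.
move=> Kc u uF; have [phi [l [phii [Kl hl]]]] := Kc u (fun n => proj1 (uF n)).
exists phi, l; split=> //; split=> //; split=> // h Kh.
apply: le_epsilon => eps e0; have [N hN] := hl (eps / 2) ltac:(lra).
have := proj2 (uF (phi N)) h Kh.
by move: (hN N (leqnn N) a) (hN N (leqnn N) b) => /Rabs_le_inv ? /Rabs_le_inv ?; lra.
Qed.

(* Lexicographic maximization of the functionals [g a + g b] over [L]. *)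
Lemma lex_max (L : seq (X * X)) K a b : seq_compact K -> pt_bounded K -> (exists g, K g) ->
  exists v, face K a b v /\
    forall g h t, K g -> K h -> 0 < t < 1 -> (forall x, v x = t * g x + (1 - t) * h x) ->
      forall p, List.In p ((a, b) :: L) -> g p.1 + g p.2 = v p.1 + v p.2.
Proof.
elim: L K a b => [|[a' b'] L IH] K a b Kc KB K0.
  have [v [Kv vm]] := face_nonempty K a b Kc KB K0; exists v; split=> //.
  move=> g h t Kg Kh t01 e _ [<-|//] /=.
  by have := vm g Kg; have := vm h Kh; rewrite !e; nra.
have [v [[vF _] vP]] := IH (face K a b) a' b' (face_seq_compact K a b Kc)
   (fun z => let: ex_intro B hB := KB z in ex_intro _ B (fun f Ff => hB f (proj1 Ff)))
   (face_nonempty K a b Kc KB K0).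
exists v; split=> // g h t Kg Kh t01 e.
have [Kv vm] := vF; have gm := vm g Kg; have hm := vm h Kh.
have ge : g a + g b = v a + v b by move: gm hm; rewrite !e; nra.
have he : h a + h b = v a + v b by move: gm hm ge; rewrite !e; nra.
move=> p [<-//|pL]; apply: (vP g h t) => //.
  by split=> // k Kk; rewrite ge; apply: vm.
by split=> // k Kk; rewrite he; apply: vm.
Qed.

(** Among the maximizers of [g a + g b], maximize the coordinates in [Z] one after another. A
    segment in [K] through the result is constant on [Z], hence everywhere. *)
Lemma vertex_maximizing K Z a b : fin_coord K Z -> seq_compact K -> pt_bounded K ->
  (exists g, K g) -> exists v, is_vertex K v /\ forall g, K g -> g a + g b <= v a + v b.
Proof.
move=> KZ Kc KB K0.
have [v [[Kv vm] vP]] := lex_max [seq (z, z) | z <- Z] K a b Kc KB K0.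
exists v; split=> //; split=> // g h t Kg Kh t01 e x.
have [z [c [zZ hz]]] := KZ x; rewrite !hz //.
have /= := vP g h t Kg Kh t01 e (z, z) (or_intror (List.in_map (fun z => (z, z)) Z z zZ)).
lra.
Qed.

End FiniteCoordinates.

Lemma finite_representatives (X : Type) (T : finType) (tau : X -> T) :
  exists Z : seq X, forall x, exists z, List.In z Z /\ tau z = tau x.
Proof.
suff H (ts : seq T) : exists Z : seq X, forall x, tau x \in ts ->
    exists z, List.In z Z /\ tau z = tau x.
  by have [Z hZ] := H (enum T); exists Z => x; apply: hZ; rewrite mem_enum.
elim: ts => [|t ts [Z hZ]]; first by exists [::].
case: (excluded_middle_informative (exists x, tau x = t)) => [[y yt]|ny].
  exists (y :: Z) => x; rewrite inE => /orP[/eqP xt|/hZ [z [zZ h]]].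
    by exists y; split; [left|rewrite yt xt].
  by exists z; split; [right|].
exists Z => x; rewrite inE => /orP[/eqP xt|/hZ //].
by case: ny; exists x.
Qed.

(** * Stable intervals *)

Section StableIntervals.
Local Open Scope nat_scope.
Variables (X : Type) (D : X -> X -> nat) (b : nat).
Hypotheses (Dxx : forall x, D x x = 0) (DC : forall x y, D x y = D y x)
  (Dtri : forall x y z, D x z <= D x y + D y z)
  (Dgeo : forall x y n, D x y = n.+1 -> exists y', D x y' = n /\ D y' y = 1)
  (Dball : forall x n, exists l : seq X, forall y, D x y <= n -> List.In y l)
  (Dst : forall x y y' v, D y y' = 1 -> D x v + D v y = D x y ->
     exists u, D x u + D u y' = D x y' /\ D v u <= b).

(* Cannon's argument for cone types, the cone of [x] at [v] being
   the set of [y] with [v] in [I(x,y)]. *)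
Lemma cone_type x x' v y :
  (forall u, D v u <= b -> D x u + D x' v = D x' u + D x v) ->
  D x v + D v y = D x y -> D x' v + D v y = D x' y.
Proof.
move=> h; move: {2}(D v y) (erefl (D v y)) => n; elim: n y => [|n IH] y vy xy.
  by have := Dtri x' v y; have := Dtri x' y v; rewrite (DC y v); lia.
have [y' [vy' y'y]] := Dgeo v y n vy.
have xy' : D x v + D v y' = D x y'.
  by have := Dtri x y' y; have := Dtri x v y'; lia.
have x'y' := IH y' vy' xy'.
(* [u] lies on a geodesic from [x'] to [y], within [b] of [v], so the hypothesis turns
   [D x y <= D x u + D u y] into [D x' v + D v y <= D x' y]. *)
have [u [x'u vu]] := Dst x' y' y v y'y x'y'.
have := h u vu; have := Dtri x u y; have := Dtri x' v y; have := Dtri v u y; lia.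
Qed.

(** Induction along a geodesic from [o] to [w]. A step away from [z] keeps the slack [K] and
    enlarges the interval; any other step uses up a unit of slack, and stability then moves the
    point by at most [b]. *)
Lemma interval_near o z w K : D z o + D o w <= D z w + K ->
  exists u, D z u + D u w = D z w /\ D o u <= b * K.
Proof.
move: {2}(D o w) (erefl (D o w)) => n; elim: n w K => [|n IH] w K ow h.
  exists o; rewrite Dxx; split; last lia.
  by have := Dtri z w o; have := Dtri z o w; rewrite (DC w o); lia.
have [w' [ow' w'w]] := Dgeo o w n ow.
have tw := Dtri z w' w.
case: (leqP (D z w) (D z w')) => zw.
  have := Dtri z o w'; case: K h => [|K] h t; first lia.
  have [u' [zu' ou']] := IH w' K ow' ltac:(lia).
  have [u [zu u'u]] := Dst z w' w u' w'w zu'.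
  by exists u; split=> //; have := Dtri o u' u; lia.
have [u [zu ou]] := IH w' K ow' ltac:(lia).
by exists u; split=> //; have := Dtri u w' w; have := Dtri z u w; lia.
Qed.

Local Open Scope R_scope.
Let d x y := INR (D x y).

Let dxx x : d x x = 0. Proof. by rewrite /d Dxx. Qed.
Let dC x y : d x y = d y x. Proof. by rewrite /d DC. Qed.
Let dtri x y z : d x z <= d x y + d y z.
Proof. by rewrite /d -plus_INR; apply: leq_INR. Qed.

(* If [z], [w] are almost tight for [f], then [I(z,w)] meets a fixed ball around [o] in
   some [v], and [w] lies in the cone of [z] at [v], hence in that of any [z'] of the same type. *)
Lemma extremal_fin_coord M o :
  exists Z : seq X, forall z, exists z', List.In z' Z /\
    forall f, inEX d f -> f o <= M -> f z - d z o = f z' - d z' o.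
Proof.
(* For a pair tight up to 1, [d x o + d o w <= d x w + 2 * M + 1], so [K] bounds its slack at
   [o]. *)
have [K hK] := INR_unbounded (2 * M + 1).
(* Radius [b * K] reaches a point [v] of the interval; the further [b] covers the ball around [v]
   compared in [cone_type]. *)
have [l hl] := Dball o (b * K + b)%nat.
pose r := (b * K + b)%nat.
(* In the ball [D z u - D z o] lies between [-r] and [r]; adding [r] makes it a natural number at
   most [2 * r], which [inord] keeps. *)
pose tau (z : X) : {ffun 'I_(size l) -> 'I_(2 * r).+1} :=
  [ffun i : 'I_(size l) => inord (D z (nth o l i) + r - D z o)%nat].
have [Z hZ] := finite_representatives X _ tau; exists Z => z.
have [z' [z'Z tz]] := hZ z; exists z'; split=> // f fE fM.
have same u : (D o u <= r)%nat -> (D z u + D z' o = D z' u + D z o)%nat.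
  move=> ou; have [i [il iu]] := List.In_nth l u o (hl u ou).
  have nthE (s : seq X) k : List.nth k s o = nth o s k by elim: s k => [|? s IH] [|k] /=.
  have il' : (i < size l)%nat by apply/ltP.
  have := congr1 (fun t : {ffun _ -> 'I_(2 * r).+1} => nat_of_ord (t (Ordinal il'))) tz.
  rewrite !ffunE /= -!nthE iu !inordK.
  - have := Dtri z o u; have := Dtri z u o.
    by have := Dtri z' o u; have := Dtri z' u o; rewrite (DC u o); lia.
  - by have := Dtri z o u; lia.
  - by have := Dtri z' o u; lia.
have le x x' : (forall u, (D o u <= r)%nat -> (D x u + D x' o = D x' u + D x o)%nat) ->
    f x - d x o <= f x' - d x' o.
  move=> xx'; apply: le_epsilon => eps e0.
  have [w hw] := inEX_tight X d dxx dC f x (Rmin eps 1) fE ltac:(apply: Rmin_pos; lra).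
  have := Rmin_l eps 1; have := Rmin_r eps 1 => m1 m2.
  have near : (D x o + D o w <= D x w + K)%nat.
    apply: INR_leq; rewrite !plus_INR -/(d x o) -/(d o w) -/(d x w).
    have := proj1 fE x o; have := proj1 fE o w.
    lra.
  have [v [xvw ov]] := interval_near o x w K near.
  have x'vw : (D x' v + D v w = D x' w)%nat.
    apply: (cone_type x) => // u vu.
    have := xx' u ltac:(rewrite /r; have := Dtri o v u; lia).
    have := xx' v ltac:(rewrite /r; lia); lia.
  have xv := xx' v ltac:(rewrite /r; lia).
  have := proj1 fE x' w; rewrite /d -x'vw.
  move: hw; rewrite /d -xvw => hw.
  have : INR (D x v + D x' o)%nat = INR (D x' v + D x o)%nat by rewrite xv.
  rewrite !plus_INR in hw *; lra.
apply: Rle_antisym; apply: le => // u ou; have := same u ou; lia.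
Qed.

Lemma geodesic_point x y (k : nat) : (k <= D x y)%nat ->
  exists v, D x v = k /\ (D x v + D v y = D x y)%nat.
Proof.
move: {2}(D x y) (erefl (D x y)) => n; elim: n y => [|n IH] y xy kn.
  by exists x; rewrite Dxx; lia.
case: (leqP k n) => kn'; last by exists y; rewrite Dxx; lia.
have [y' [xy' y'y]] := Dgeo x y n xy.
have [v [xv vy']] := IH y' xy' ltac:(lia).
exists v; split=> //; have := Dtri v y' y; have := Dtri x v y; lia.
Qed.

Lemma nat_floor r (n : nat) : 0 <= r < INR n -> exists k : nat, INR k <= r < INR k + 1.
Proof.
elim: n => [|n IH]; first by rewrite /=; lra.
rewrite S_INR => rn; case: (Rlt_le_dec r (INR n)) => h; first by apply: IH; lra.
by exists n; lra.
Qed.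

(* An extremal function is almost minimal at the point [v] of a geodesic [xy], with [x], [y]
   almost tight for [f], that splits the length into roughly [f x] and [f y]. *)
Lemma hyperbolic_near delta f (o : X) : hyperbolic d delta -> inEX d f ->
  exists v, f v <= delta + 2.
Proof.
move=> hyp fE; have f0 x := inDelta_ge0 X d dxx f x (proj1 fE).
have [y hy] := inEX_tight X d dxx dC f o (1 / 2) fE ltac:(lra).
have [n hn] := INR_unbounded (f o).
have [k hk] := nat_floor (f o) n ltac:(have := f0 o; lra).
have kD : (k <= D o y)%nat.
  suff : (k < (D o y).+1)%nat by [].
  apply/ltP; apply: INR_lt; rewrite S_INR -/(d o y); have := f0 y; lra.
have [v [ov vy]] := geodesic_point o y k kD.
have ov' : d o v = INR k by rewrite /d ov.
have vy' : d o v + d v y = d o y by rewrite /d -vy plus_INR.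
have [w hw] := inEX_tight X d dxx dC f v (1 / 2) fE ltac:(lra).
exists v; have := hyp v w o y; have := proj1 fE w y; have := proj1 fE w o.
rewrite (dC v o) => h1 h2 h3; have h4 := proj1 fE o y.
(* The 1 is lost by rounding [f o] down to [k]; with the two tolerances [1 / 2] it makes up the 2 of
   the conclusion. *)
have : Rmax (d o v + d w y) (d w o + d v y) <= f w + f o + f y + 1 by apply: Rmax_lub; lra.
lra.
Qed.

End StableIntervals.

(** * Extensionality, finite sums, and monotone maps of finite chains *)

Lemma pred_ext (T : Type) (P Q : T -> Prop) : (forall x, P x <-> Q x) -> P = Q.
Proof. by move=> h; apply: functional_extensionality => x; apply: propositional_extensionality. Qed.

Lemma rel_ext (T : Type) (P Q : T -> T -> Prop) : (forall x y, P x y <-> Q x y) -> P = Q.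
Proof. by move=> h; apply: functional_extensionality => x; apply: pred_ext. Qed.

Lemma sumR_add (T : Type) (F H : T -> R) s :
  sumR [seq F v | v <- s] + sumR [seq H v | v <- s] = sumR [seq F v + H v | v <- s].
Proof. by elim: s => /= [|v s <-]; lra. Qed.

Lemma sumR_ge (T : Type) (F : T -> R) s m : (forall v, List.In v s -> m <= F v) ->
  INR (size s) * m <= sumR [seq F v | v <- s] /\
  ((exists v, List.In v s /\ m < F v) -> INR (size s) * m < sumR [seq F v | v <- s]).
Proof.
elim: s => [|v s IH] h; first by split=> /=; [lra|move=> [? []]].
have [IH1 IH2] := IH (fun w ws => h w (or_intror ws)).
have hv := h v (or_introl erefl).
rewrite [size _]/= S_INR /=; split; first lra.
move=> [w [[<-|ws] hw]]; first lra.
by have := IH2 (ex_intro _ w (conj ws hw)); lra.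
Qed.

Lemma sumR_perm s t : Permutation s t -> sumR s = sumR t.
Proof.
elim=> //= [x s' t' _ -> //|x y s'|s1 s2 s3 _ -> _ -> //].
lra.
Qed.

Lemma sumR_indicator (c : nat -> R) k s : uniq s ->
  sumR [seq c i * (if k == i then 1 else 0) | i <- s] = if k \in s then c k else 0.
Proof.
elim: s => //= i s IH /andP[/negbTE nis us]; rewrite in_cons (IH us).
by have [->|_] := eqVneq k i; rewrite ?nis /=; [|case: ifP => _]; lra.
Qed.

Lemma zip_map_map (T A B : Type) (F : T -> A) (H : T -> B) s :
  zip [seq F i | i <- s] [seq H i | i <- s] = [seq (F i, H i) | i <- s].
Proof. by elim: s => //= i s ->. Qed.

(** No tail element maps to the least element [a0], because its image lies above [T a0], which is at
    least [a0]; so induction fixes the tail. Were [T a0] in the tail, it would be fixed, yet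
    monotonicity gives [lt (T a0) (T (T a0))]. *)
Lemma monotone_chain_fix (U : Type) (lt : U -> U -> Prop) (T : U -> U) (l : seq U) :
  (forall a, ~ lt a a) -> (forall a b c, lt a b -> lt b c -> lt a c) ->
  (forall a b, lt a b -> lt (T a) (T b)) ->
  StronglySorted lt l -> (forall a, List.In a l -> List.In (T a) l) ->
  forall a, List.In a l -> T a = a.
Proof.
move=> irr tr mono; elim: l => //= a0 l IH a0sl Tl.
have [sl fa] := StronglySorted_inv a0sl; have a0l := proj1 (List.Forall_forall _ _) fa.
have {}IH a : List.In a l -> T a = a.
  apply: IH => // {}a al.
  have a0a := mono _ _ (a0l a al).
  have : lt a0 (T a).
    by case: (Tl a0 (or_introl erefl)) => [->//|/a0l h]; exact: (tr _ (T a0)).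
  by case: (Tl a (or_intror al)) => // <- /irr.
move=> a [<-|]; last exact: IH.
case: (Tl a0 (or_introl erefl)) => [//|h].
by have := mono _ _ (a0l _ h); rewrite (IH (T a0) h) => /irr.
Qed.

(** * Cells and barycenters *)

Section Cells.
Variables (X : Type) (d : X -> X -> R).
Hypotheses (dxx : forall x, d x x = 0) (dC : forall x y, d x y = d y x)
  (Hfc : forall M o, exists Z : seq X, forall z, exists z', List.In z' Z /\
     forall f, inEX d f -> f o <= M -> f z - d z o = f z' - d z' o).
Implicit Types (f g b : X -> R) (C : (X -> R) -> Prop).

Lemma is_cellP C : is_cell d C ->
  exists f, inEX d f /\ (forall x, exists y, Aof d f x y) /\ C = Pcell d (Aof d f).
Proof.
move=> [A [[f [fD [fA fc]]] CA]].
have AE : A = Aof d f by apply: rel_ext.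
subst A; exists f; split; first exact: cover_inEX.
by split=> //; apply: pred_ext.
Qed.

Lemma Aof_cell f : inEX d f -> (forall x, exists y, Aof d f x y) ->
  is_cell d (Pcell d (Aof d f)).
Proof. by move=> [fD _] fc; exists (Aof d f); split=> //; exists f. Qed.

Lemma Pcell_pt_bounded f : (forall x, exists y, Aof d f x y) -> pt_bounded X (Pcell d (Aof d f)).
Proof.
move=> fc z; have [y zy] := fc z; exists (d z y) => g [gE gA].
have g0 x : 0 <= g x by apply: inDelta_ge0 (proj1 gE).
by rewrite Rabs_pos_eq //; have := gA z y zy; have := g0 y; lra.
Qed.

Lemma Pcell_unif_closed f : unif_closed X (Pcell d (Aof d f)).
Proof.
move=> g gl; split.
  by apply: inEX_closed => // eps /gl [h [[hE _] hg]]; exists h.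
move=> x y xy; apply: cond_eq => eps e0.
have [h [[_ hA] hg]] := gl (eps / 3) ltac:(lra).
apply: Rle_lt_trans (_ : 2 * (eps / 3) < _); last lra.
by apply: Rabs_le; rewrite -(hA x y xy); move: (hg x) (hg y) => /Rabs_le_inv ? /Rabs_le_inv ?; lra.
Qed.

Lemma Pcell_fin_coord f (o : X) : (forall x, exists y, Aof d f x y) ->
  exists Z, fin_coord X (Pcell d (Aof d f)) Z.
Proof.
move=> fc; have [M hM] := Pcell_pt_bounded f fc o.
have [Z hZ] := Hfc M o; exists Z => z.
have [z' [z'Z h]] := hZ z; exists z', (d z o - d z' o); split=> // g gP.
have := h g (proj1 gP) ltac:(by move: (hM g gP) => /Rabs_le_inv; lra); lra.
Qed.

(** A vertex maximizing [g x + g y] on the cell does at least as well as [f], whose sum exceeds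
    [d x y]. *)
Lemma cell_vertex f x y : inEX d f -> (forall x, exists y, Aof d f x y) -> ~ Aof d f x y ->
  exists v, is_vertex (Pcell d (Aof d f)) v /\ d x y < v x + v y.
Proof.
move=> fE fc nxy; have [Z hZ] := Pcell_fin_coord f x fc.
have fP : Pcell d (Aof d f) f by [].
have fB := Pcell_pt_bounded f fc.
have [v [vv vm]] := vertex_maximizing X _ Z x y hZ
   (fin_coord_seq_compact X _ Z hZ fB (Pcell_unif_closed f)) fB (ex_intro _ f fP).
exists v; split=> //; apply: Rlt_le_trans (vm f fP).
by case: (proj1 fE x y) => // e; case: nxy.
Qed.

(* Every non-tight pair is non-tight at some vertex, so averaging all vertices yields
   a point of the relative interior. *)
Lemma barycenter_Aof f b : inEX d f -> (forall x, exists y, Aof d f x y) ->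
  is_barycenter (Pcell d (Aof d f)) b -> inDelta d b /\ Aof d b = Aof d f.
Proof.
move=> fE fc [vs [_ [vs0 [vsP bE]]]].
have n0 : 0 < INR (size vs).
  by apply: lt_0_INR; case: vs vs0 {vsP bE} => //= *; lia.
have bxy x y : (b x + b y) * INR (size vs) = sumR [seq v x + v y | v <- vs].
  by rewrite !bE -sumR_add; field; lra.
have vD x y v : List.In v vs -> d x y <= v x + v y.
  by move=> /vsP [[[vD _] _] _].
split=> [x y|].
  by have [h _] := sumR_ge _ (fun v => v x + v y) vs (d x y) (vD x y); rewrite -bxy in h; nra.
apply: rel_ext => x y; split=> h.
  apply: NNPP => /(cell_vertex f x y fE fc) [v [/vsP vv lt]].
  have [_ h'] := sumR_ge _ (fun v => v x + v y) vs (d x y) (vD x y).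
  have := h' (ex_intro _ v (conj vv lt)); rewrite -bxy h; lra.
(* On a tight pair every vertex has equality; bounding the negated sums from below supplies the
   reverse inequality. *)
have [h' _] := sumR_ge _ (fun v => - (v x + v y)) vs (- d x y)
   (fun v vv => ltac:(have [[_ e] _] := proj1 (vsP v) vv; have := e x y h; lra)).
have [h'' _] := sumR_ge _ (fun v => v x + v y) vs (d x y) (vD x y).
have e : sumR [seq - (v x + v y) | v <- vs] + sumR [seq v x + v y | v <- vs] = 0.
  by rewrite sumR_add; elim: (vs) => //= v s ->; lra.
by rewrite -bxy in h'' e; rewrite /Aof; nra.
Qed.

Lemma barycenter_unique C b b' : is_barycenter C b -> is_barycenter C b' -> b = b'.
Proof.
move=> [vs [vsN [_ [vsP bE]]]] [vs' [vsN' [_ [vsP' bE']]]].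
have p : Permutation vs vs'.
  by apply: NoDup_Permutation => // v; rewrite vsP vsP'.
apply: functional_extensionality => x; rewrite bE bE'.
rewrite (sumR_perm _ _ (Permutation_map (fun v => v x) p)).
by rewrite -[size vs]/(length vs) (Permutation_length p).
Qed.

(** Strict inclusion, reversed: a larger cell has fewer tight pairs, so increasing chains of cells
    increase for [rel_lt]. *)
Definition rel_lt (A A' : X -> X -> Prop) : Prop :=
  (forall x y, A' x y -> A x y) /\ exists x y, A x y /\ ~ A' x y.

Lemma rel_lt_irr A : ~ rel_lt A A.
Proof. by move=> [_ [x [y [? ?]]]]. Qed.

Lemma rel_lt_trans A B E : rel_lt A B -> rel_lt B E -> rel_lt A E.
Proof.
move=> [AB [x [y [Axy nB]]]] [BE _]; split=> [u v /BE /AB //|].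
by exists x, y; split=> // /BE.
Qed.

Lemma cell_rel_lt f f' : inEX d f ->
  (forall g, Pcell d (Aof d f) g -> Pcell d (Aof d f') g) ->
  (exists g, Pcell d (Aof d f') g /\ ~ Pcell d (Aof d f) g) ->
  rel_lt (Aof d f) (Aof d f').
Proof.
move=> fE sub [g [[gE gf'] ng]].
split; first by have [_ h] := sub f (conj fE (fun _ _ h => h)).
apply: NNPP => H; apply: ng; split=> // x y xy; apply: NNPP => gxy.
by apply: H; exists x, y; split=> // /gf'.
Qed.

(** By [barycenter_Aof] each barycenter [b] recovers its cell as [Pcell d (Aof d b)], so the tight
    relations of the barycenters encode the chain. *)
Lemma simplex_chain cs bs : List.Forall (is_cell d) cs -> strict_chain cs ->
  List.Forall2 (@is_barycenter X) cs bs ->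
  StronglySorted rel_lt [seq Aof d b | b <- bs] /\
  List.Forall (fun b => inDelta d b /\ (forall x, exists y, Aof d b x y) /\
                 is_barycenter (Pcell d (Aof d b)) b) bs.
Proof.
move=> cC cs_chain csbs; split.
  apply: Sorted_StronglySorted; first exact: rel_lt_trans.
  elim: csbs cC cs_chain => {cs bs} [|C b cs bs Cb csbs IH] cC cs_chain /=; first by constructor.
  have [cC0 cC1] := List.Forall_inv cC; have cCt := List.Forall_inv_tail cC.
  have {}IH : Sorted rel_lt [seq Aof d b | b <- bs].
    by apply: IH => //; case: (cs) cs_chain => // C' cs' [].
  constructor=> //.
  case: csbs cCt cs_chain {IH} => /= [|C' b' cs' bs' C'b' _ cCt [[s1 s2] _]]; constructor.
  have [f [fE [fc ?]]] := is_cellP C (List.Forall_inv cC).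
  have [f' [f'E [f'c ?]]] := is_cellP C' (List.Forall_inv cCt); subst C C'.
  rewrite (proj2 (barycenter_Aof f b fE fc Cb)) (proj2 (barycenter_Aof f' b' f'E f'c C'b')).
  exact: cell_rel_lt.
elim: csbs cC {cs_chain} => {cs bs} [|C b cs bs Cb csbs IH] cC; constructor; last first.
  by apply: IH; apply: List.Forall_inv_tail cC.
have [f [fE [fc ?]]] := is_cellP C (List.Forall_inv cC); subst C.
by have [bD ->] := barycenter_Aof f b fE fc Cb.
Qed.

(** All terms are nonnegative, so [slack] vanishes exactly where every [b] of positive weight is
    tight. Tight relations shrink along [bs], so the last such [b] decides. The zero-weight
    alternative serves the induction. *)
Lemma weighted_slack (bs : seq (X -> R)) (ts : seq R) : size ts = size bs ->
  StronglySorted rel_lt [seq Aof d b | b <- bs] -> List.Forall (inDelta d) bs ->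
  List.Forall (fun t => 0 <= t) ts ->
  let slack x y := sumR [seq p.1 * (p.2 x + p.2 y - d x y) | p <- zip ts bs] in
  (forall x y, 0 <= slack x y) /\
  ((forall x y, slack x y = 0) /\ sumR ts = 0 \/ 0 < sumR ts /\
     exists b, List.In b bs /\ forall x y, slack x y = 0 <-> Aof d b x y).
Proof.
elim: ts bs => [|t ts IH] [|b bs] //=; first by split=> [x y|]; [apply: Rle_refl|left].
move=> [] sz bbs_s bsD ts0.
have [bs_s fa] := StronglySorted_inv bbs_s; have bbs := proj1 (List.Forall_forall _ _) fa.
have [s0 IH'] := IH bs sz bs_s (List.Forall_inv_tail bsD) (List.Forall_inv_tail ts0).
have t0 := List.Forall_inv ts0; have bD := List.Forall_inv bsD; rewrite /= in t0 bD.
split=> [x y|]; first by have := s0 x y; have := bD x y; nra.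
case: IH' => [[z0 ->]|[p0 [b' [b'bs h]]]].
  case: t0 => [t0|<-]; last by left; split=> [x y|]; rewrite ?z0; lra.
  right; split; first lra.
  exists b; split=> [|x y]; first by left.
  by rewrite z0 /Aof; split=> e; [have := bD x y; nra|rewrite e; lra].
right; split; first lra.
exists b'; split=> [|x y]; first by right.
have := s0 x y; have := bD x y => h1 h2; split=> [e|e].
  by apply/h; nra.
have [+ _] := bbs _ (List.in_map (Aof d) bs b' b'bs) => /(_ x y e); rewrite /Aof => ->.
by move/h: e => ->; lra.
Qed.

(** As the weights sum to 1, the slack of [g] is the weighted slack of [bs]. *)
Lemma conv_hull_Aof (bs : seq (X -> R)) g :
  StronglySorted rel_lt [seq Aof d b | b <- bs] -> List.Forall (inDelta d) bs ->
  conv_hull bs g -> exists b, List.In b bs /\ Aof d g = Aof d b.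
Proof.
move=> bs_s bsD [ts [sz [ts0 [ts1 gE]]]].
have [_ [[_ ]|[_ [b [bbs h]]]]] := weighted_slack bs ts sz bs_s bsD ts0; first lra.
exists b; split=> //; apply: rel_ext => x y; rewrite -h.
suff -> : sumR [seq p.1 * (p.2 x + p.2 y - d x y) | p <- zip ts bs] = g x + g y - sumR ts * d x y.
  by rewrite ts1 /Aof; split; lra.
rewrite !gE; elim: (ts) (bs) sz => [|t ts' IH] [|b' bs'] //=; first by move=> _; ring.
by move=> [] /IH ->; ring.
Qed.

Lemma conv_hull_mem (bs : seq (X -> R)) b : List.In b bs -> conv_hull bs b.
Proof.
have z0 (s : seq (X -> R)) x : sumR [seq p.1 * p.2 x | p <- zip (nseq (size s) 0) s] = 0.
  by elim: s => //= b' s ->; lra.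
have n0 n : List.Forall (fun t => 0 <= t) (nseq n 0) /\ sumR (nseq n 0) = 0.
  by elim: n => [|n [IH1 IH2]] /=; split; try constructor; try lra.
elim: bs => //= b' bs IH [->|/IH [ts [sz [ts0 [ts1 bE]]]]].
  exists (1 :: nseq (size bs) 0); have [h1 h2] := n0 (size bs); split; first by rewrite /= size_nseq.
  by split; [constructor=> //; lra|split=> [|x] /=; rewrite ?h2 ?z0; lra].
exists (0 :: ts); split; first by rewrite /= sz.
by split; [constructor=> //; lra|split=> [|x] /=; rewrite ?ts1 ?bE; lra].
Qed.

(* Moving slightly from [f] towards a point of the cell does not increase the value at
   [o] by more than 1, and the finitely many linear constraints are homogeneous in the direction. *)
Lemma cell_affdim M o : exists n, forall f, inEX d f -> (forall x, exists y, Aof d f x y) ->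
  f o <= M -> affdim_le (Pcell d (Aof d f)) n.
Proof.
have [Z hZ] := Hfc (M + 1) o; exists (size Z) => f fE fc fM.
have idxE z : exists i, (i < size Z)%nat /\
    forall g, inEX d g -> g o <= M + 1 -> g z - d z o = g (nth o Z i) - d (nth o Z i) o.
  have [z' [z'Z h]] := hZ z; have [i [il iz]] := List.In_nth Z z' o z'Z.
  have nthE (s : seq X) k : List.nth k s o = nth o s k by elim: s k => [|? s IH] [|k] /=.
  by exists i; split; [apply/ltP|rewrite -nthE iz].
pose idx z := proj1_sig (constructive_indefinite_description _ (idxE z)).
have idxP z := proj2_sig (constructive_indefinite_description _ (idxE z)).
(* The base point is [f]; the directions are the indicators of the classes of [idx], on which
   [g - f] is constant. *)
exists f, [seq (fun z => if idx z == i then 1 else 0) | i <- iota 0 (size Z)].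
split=> [|g [gE gA]]; first by rewrite size_map size_iota.
exists [seq g (nth o Z i) - f (nth o Z i) | i <- iota 0 (size Z)].
split=> [|z]; first by rewrite size_map size_iota.
rewrite zip_map_map -map_comp.
rewrite (sumR_indicator (fun i => g (nth o Z i) - f (nth o Z i)) (idx z)) ?iota_uniq //.
have [il ih] := idxP z; rewrite -/(idx z) in il ih.
rewrite mem_iota il /=.
have g0 := inDelta_ge0 X d dxx g o (proj1 gE).
pose t := / (1 + g o).
have t0 : 0 < t by apply: Rinv_0_lt_compat; lra.
have t1 : t * (1 + g o) = 1 by apply: Rinv_l; lra.
have hE : inEX d (fun x => (1 - t) * f x + t * g x).
  apply: cover_inEX => //.
    by apply: inDelta_convex (proj1 fE) (proj1 gE); nra.
  move=> x; have [y xy] := fc x; exists y.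
  by have := gA x y xy; rewrite -xy => e; nra.
have f0 := inDelta_ge0 X d dxx f o (proj1 fE).
have := ih _ hE ltac:(nra); have := ih f fE ltac:(lra); nra.
Qed.

End Cells.

Lemma seq_inE (T : eqType) (x : T) (s : seq T) : x \in s -> List.In x s.
Proof. by elim: s => // y s IH; rewrite inE => /orP[/eqP ->|/IH]; [left|right]. Qed.

(** * The word metric *)

Section WordMetric.
Local Open Scope group_scope.
Variables (G : groupType) (S : seq G).
Hypothesis Sgen : generates S.

Lemma letterV (a : G) : letter S a^-1 = letter S a.
Proof. by rewrite /letter invgK orbC. Qed.

Lemma word_prod_cat (w w' : seq G) : word_prod (w ++ w') = word_prod w * word_prod w'.
Proof. by elim: w => /= [|a w ->]; rewrite ?mul1g ?mulgA. Qed.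

Lemma word_prodV (w : seq G) : word_prod (rev [seq a^-1 | a <- w]) = (word_prod w)^-1.
Proof.
elim: w => /= [|a w IH]; first by rewrite invg1.
by rewrite rev_cons -cats1 word_prod_cat IH /= mulg1 invgM.
Qed.

Lemma wlenP (x : G) : reach S (wlen S x) x /\ forall m, reach S m x -> (wlen S x <= m)%nat.
Proof.
apply: (epsilon_spec (inhabits O) (fun n => reach S n x /\ forall m, reach S m x -> (n <= m)%nat)).
have [w [wS wx]] := Sgen x.
have [n [[nP nm] _]] := dec_inh_nat_subset_has_unique_least_element
   (fun n => reach S n x) (fun n => classic _) (ex_intro _ (size w) (ex_intro _ w (conj wS (conj erefl wx)))).
by exists n; split=> // m /nm; lia.
Qed.

Lemma wlen_le (w : seq G) : all (letter S) w -> (wlen S (word_prod w) <= size w)%nat.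
Proof. by move=> wS; apply: (proj2 (wlenP _)); exists w. Qed.

Lemma wlen1 : wlen S 1 = O.
Proof. by have := wlen_le [::] isT; rewrite /=; lia. Qed.

Lemma wlenV_le (x : G) : (wlen S x^-1 <= wlen S x)%nat.
Proof.
have [[w [wS [<- <-]]] _] := wlenP x.
rewrite -word_prodV -(size_map (fun a : G => a^-1)) -size_rev; apply: wlen_le.
by rewrite all_rev all_map; apply: sub_all wS => a /=; rewrite letterV.
Qed.

Lemma wlenM (x y : G) : (wlen S (x * y) <= wlen S x + wlen S y)%nat.
Proof.
have [[w [wS [<- xw]]] _] := wlenP x; have [[w' [wS' [<- yw']]] _] := wlenP y.
by rewrite -{1}xw -{1}yw' -word_prod_cat -size_cat; apply: wlen_le; rewrite all_cat wS.
Qed.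

Definition wdist (x y : G) : nat := wlen S (x^-1 * y).

Lemma wdistxx x : wdist x x = O.
Proof. by rewrite /wdist mulVg wlen1. Qed.

Lemma wdistC x y : wdist x y = wdist y x.
Proof.
have h u v : (wdist u v <= wdist v u)%nat.
  by rewrite /wdist -[u^-1 * v]invgK invgM invgK; apply: wlenV_le.
by have := h x y; have := h y x; lia.
Qed.

Lemma wdist_tri x y z : (wdist x z <= wdist x y + wdist y z)%nat.
Proof.
rewrite /wdist; have -> : x^-1 * z = (x^-1 * y) * (y^-1 * z) by rewrite -mulgA mulVKg.
exact: wlenM.
Qed.

(** Drop the last letter of a shortest word; the triangle inequality turns both upper bounds into
    equalities. *)
Lemma wdist_geo x y n : wdist x y = n.+1 -> exists y', wdist x y' = n /\ wdist y' y = 1%nat.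
Proof.
move=> xy; have [[w [wS [wsz wp]]] _] := wlenP (x^-1 * y).
rewrite -/(wdist x y) xy in wsz.
case/lastP: w wS wsz wp => // w a; rewrite all_rcons size_rcons => /andP[aS wS] [wsz].
rewrite -cats1 word_prod_cat /= mulg1 => wp.
exists (x * word_prod w).
have h1 : (wdist x (x * word_prod w) <= n)%nat by rewrite /wdist mulKg -wsz; apply: wlen_le.
have h2 : (wdist (x * word_prod w) y <= 1)%nat.
  rewrite /wdist invgM -mulgA -wp mulKg -[a]mulg1.
  by apply: (wlen_le [:: a]); rewrite /= aS.
have := wdist_tri x (x * word_prod w) y; lia.
Qed.

Lemma wball (n : nat) : exists l : seq G, forall x, (wlen S x <= n)%nat -> x \in l.
Proof.
elim: n => [|n [l hl]].
  exists [:: 1] => x x0; have [[w [_ [sz <-]]] _] := wlenP x.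
  by case: w sz => [|a w] /=; [rewrite inE|lia].
exists (1 :: [seq a * y | a <- S ++ [seq a^-1 | a <- S], y <- l]) => x xn.
have [[w [wS [sz <-]]] _] := wlenP x.
case: w wS sz => [|a w] /=; first by rewrite inE eqxx.
move=> /andP[aS wS] sz; rewrite inE; apply/orP; right.
apply: allpairs_f; last by apply: hl; have := wlen_le w wS; lia.
rewrite mem_cat; case/orP: aS => [->//|aS].
by rewrite -[a]invgK map_f ?orbT.
Qed.

Lemma wdist_ball (x : G) n : exists l : seq G, forall y, (wdist x y <= n)%nat -> List.In y l.
Proof.
have [l hl] := wball n; exists [seq x * y | y <- l] => y /hl h.
by apply: seq_inE; rewrite -[y](mulVKg x) map_f.
Qed.

Lemma dS_act x y z : dS S (x * y) (x * z) = dS S y z.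
Proof. by rewrite /dS invgM -mulgA mulKg. Qed.

End WordMetric.

(** * The action on the injective hull *)

Section Action.
Variables (G : groupType) (S : seq G).
Hypothesis Sgen : generates S.
Notation d := (dS S).
Implicit Types (f g b : G -> R) (C : (G -> R) -> Prop).

Lemma dSxx x : d x x = 0.
Proof. by rewrite /dS -/(wdist G S x x) wdistxx. Qed.

Lemma dSC x y : d x y = d y x.
Proof. by rewrite /dS -/(wdist G S x y) wdistC. Qed.

Lemma dS_tri x y z : d x z <= d x y + d y z.
Proof. by rewrite /dS -plus_INR; apply: leq_INR; apply: wdist_tri. Qed.

Lemma dS_ball r : exists l : seq G, forall x, d 1%g x <= r -> x \in l.
Proof.
have [n hn] := INR_unbounded r; have [l hl] := wball G S Sgen n.
exists l => x; rewrite /dS invg1 mul1g => h; apply: hl; apply: INR_leq; lra.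
Qed.

Lemma act1 f : act 1%g f = f.
Proof. by apply: functional_extensionality => z; rewrite /act invg1 mul1g. Qed.

Lemma actM x y f : act (x * y)%g f = act x (act y f).
Proof. by apply: functional_extensionality => z; rewrite /act invgM mulgA. Qed.

Lemma actK x : cancel (@act G x) (act x^-1%g).
Proof. by move=> f; rewrite -actM mulVg act1. Qed.

Lemma actVK x : cancel (act x^-1%g) (@act G x).
Proof. by move=> f; rewrite -actM mulgV act1. Qed.

Lemma dS_actV x y z : d (x^-1 * y)%g (x^-1 * z)%g = d y z.
Proof. exact: dS_act. Qed.

Lemma act_inDelta x f : inDelta d f -> inDelta d (act x f).
Proof. by move=> fD y z; rewrite -(dS_actV x); apply: fD. Qed.

Lemma act_inEX x f : inEX d f -> inEX d (act x f).
Proof.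
move=> [fD fmin]; split; first exact: act_inDelta.
move=> g gD gf y; have gf' z : act x^-1%g g z <= f z by rewrite -[f](actK x); apply: gf.
by have := fmin _ (act_inDelta _ _ gD) gf' (x^-1 * y)%g; rewrite {1}/act invgK mulVKg.
Qed.

Lemma Aof_act x f : Aof d (act x f) = fun u v => Aof d f (x^-1 * u)%g (x^-1 * v)%g.
Proof. by apply: rel_ext => u v; rewrite /Aof dS_actV. Qed.

Lemma act_imgE x C : act_img x C = fun g => C (act x^-1%g g).
Proof.
apply: pred_ext => g; split=> [[f [Cf gf]]|Cg].
  have -> : g = act x f by exact: functional_extensionality.
  by rewrite actK.
by exists (act x^-1%g g); split=> // z; rewrite actVK.
Qed.

Lemma act_imgK x C : act_img x^-1%g (act_img x C) = C.
Proof. by apply: pred_ext => g; rewrite !act_imgE actVK. Qed.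

Lemma act_img_Pcell x f : act_img x (Pcell d (Aof d f)) = Pcell d (Aof d (act x f)).
Proof.
rewrite act_imgE Aof_act; apply: pred_ext => g; split=> [[gE gA]|[gE gA]]; split.
- by rewrite -[g](actVK x); apply: act_inEX.
- by move=> u v /gA; rewrite /act invgK dS_actV !mulVKg.
- exact: act_inEX.
- by move=> u v uv; rewrite /act invgK -(dS_act G S x); apply: gA; rewrite !mulKg.
Qed.

Lemma act_is_cell x C : is_cell d C -> is_cell d (act_img x C).
Proof.
move=> /is_cellP [f [fE [fc ->]]]; rewrite act_img_Pcell.
apply: Aof_cell; first exact: act_inEX.
move=> y; rewrite Aof_act; have [z yz] := fc (x^-1 * y)%g.
by exists (x * z)%g; rewrite mulKg.
Qed.

Lemma act_is_vertex x C v : is_vertex C v -> is_vertex (act_img x C) (act x v).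
Proof.
rewrite act_imgE => -[Cv ve]; split; first by rewrite actK.
move=> g h t Cg Ch t01 e z.
have := ve _ _ t Cg Ch t01; rewrite /act invgK => ve'.
have := ve' _ (x^-1 * z)%g; rewrite mulVKg; apply=> y.
by rewrite -[y in LHS](mulKg x) -/(act x v (x * y)%g) e.
Qed.

Lemma act_is_barycenter x C b : is_barycenter C b -> is_barycenter (act_img x C) (act x b).
Proof.
move=> [vs [vsN [vs0 [vsP bE]]]]; exists [seq act x v | v <- vs].
split; first by apply: FinFun.Injective_map_NoDup => //; apply: can_inj (actK x).
split; first by case: (vs) vs0.
split=> [v|z]; last by rewrite size_map -map_comp /act bE.
split=> [/List.in_map_iff [w [<- /vsP]]|/(act_is_vertex x^-1%g)]; first exact: act_is_vertex.
by rewrite act_imgK => /vsP h; rewrite -[v](actVK x); apply: List.in_map.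
Qed.

Lemma act_strict_chain x (cs : seq ((G -> R) -> Prop)) :
  strict_chain cs -> strict_chain [seq act_img x C | C <- cs].
Proof.
elim: cs => //= C [|C' cs] //= IH [[sub [g [C'g nCg]]] /IH h]; split=> //.
rewrite !act_imgE; split=> [f|]; first exact: sub.
by exists (act x g); rewrite actK.
Qed.

Lemma act_conv_hull x (bs : seq (G -> R)) :
  act_img x (conv_hull bs) = conv_hull [seq act x b | b <- bs].
Proof.
have sumE (ts : seq R) z : sumR [seq p.1 * p.2 z | p <- zip ts [seq act x b | b <- bs]] =
    sumR [seq p.1 * p.2 (x^-1 * z)%g | p <- zip ts bs].
  by elim: ts (bs) => [|t ts IH] [|b bs'] //=; rewrite IH.
rewrite act_imgE; apply: pred_ext => g; split=> -[ts [sz [ts0 [ts1 gE]]]]; exists ts.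
  rewrite size_map; do 3!split=> //; move=> z.
  by rewrite sumE -gE /act invgK mulVKg.
rewrite size_map in sz; do 3!split=> //; move=> z.
by rewrite /act invgK gE sumE mulKg.
Qed.

Lemma act_subdiv_simplex x sigma : subdiv_simplex d sigma -> subdiv_simplex d (act_img x sigma).
Proof.
move=> [cs [bs [cs0 [csC [chain [csbs sE]]]]]].
exists [seq act_img x C | C <- cs], [seq act x b | b <- bs].
split; first by case: (cs) cs0.
split.
  by elim: csC => //= C cs' CC _ IH; constructor=> //; apply: act_is_cell.
split; first exact: act_strict_chain.
split.
  by elim: csbs => //= C b cs' bs' Cb _ IH; constructor=> //; apply: act_is_barycenter.
by move=> g; rewrite -act_conv_hull (pred_ext _ _ _ sE).
Qed.

Lemma act_rel_lt x A A' : rel_lt G A A' ->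
  rel_lt G (fun u v => A (x^-1 * u)%g (x^-1 * v)%g) (fun u v => A' (x^-1 * u)%g (x^-1 * v)%g).
Proof.
move=> [sub [u [v [Auv nA]]]]; split=> [? ?|]; first exact: sub.
by exists (x * u)%g, (x * v)%g; rewrite !mulKg.
Qed.

(** * Finite stabilizers, properness and fixed point sets *)

Lemma finite_fixed_point (H : G -> Prop) f : fixE S H f -> finite_set H.
Proof.
(* Invariance gives [f x = f 1] on [H], so [H] lies in the ball of radius [2 * f 1] around 1. *)
move=> [[fD _] fH]; have [l hl] := dS_ball (f 1%g + f 1%g); exists l => x Hx.
apply: hl; have := fD 1%g x; have := fH x Hx x; rewrite /act mulVg => ->; lra.
Qed.

(** [g 1] is the value of [act x g] at [x], so it is close to both [f 1] and [f x]; hence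
    [f x < f 1 + 2], which bounds [d 1 x]. *)
Lemma act_proper f : exists l : seq G, forall x,
  (exists g, inEX d g /\ dist_lt f g 1 /\ dist_lt f (act x g) 1) -> inDelta d f -> x \in l.
Proof.
have [l hl] := dS_ball (2 * f 1%g + 2); exists l => x [g [gE [[r [r1 fg]] [s [s1 fxg]]]]] fD.
apply: hl; have := fD 1%g x; have /Rabs_le_inv := fg 1%g; have /Rabs_le_inv := fxg x.
have -> : act x g x = g 1%g by rewrite /act mulVg.
lra.
Qed.

Lemma subgroupV (H : G -> Prop) x : subgroup H -> H x -> H x^-1%g.
Proof. by move=> [H1 HV] Hx; rewrite -[x^-1%g]mul1g; apply: HV. Qed.

Lemma subgroupM (H : G -> Prop) x y : subgroup H -> H x -> H y -> H (x * y)%g.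
Proof. by move=> Hs Hx Hy; rewrite -[y]invgK; apply: (proj2 Hs) => //; apply: subgroupV. Qed.

(** The largest distance to a point of [H] is an [H]-invariant function in Delta, and the
    equivariant retraction makes it extremal. *)
Lemma fixE_inhabited (H : G -> Prop) : subgroup H -> finite_set H -> exists c, fixE S H c.
Proof.
move=> Hs [l Hl]; pose f x := supR (fun r => exists h, H h /\ r = d x h).
have fge x h : H h -> d x h <= f x.
  move=> Hh; have [ub _] : is_lub (fun r => exists h, H h /\ r = d x h) (f x).
    apply: supR_lub; first by exists (d x h), h.
    have [B hB] : exists B, forall h, h \in l -> d x h <= B.
      elim: (l) => [|a s [B hB]]; first by exists 0.
      exists (Rmax (d x a) B) => k; rewrite in_cons => /orP[/eqP ->|/hB ks].
        exact: Rmax_l.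
      exact: Rle_trans ks (Rmax_r _ _).
    by exists B => _ [k [Hk ->]]; apply: hB; apply: Hl.
  by apply: ub; exists h.
have H1 := proj1 Hs.
have fD : inDelta d f.
  move=> x y; have := dS_tri x 1%g y; have := fge x 1%g H1; have := fge y 1%g H1.
  by rewrite (dSC y 1%g); lra.
have fH h z : H h -> f (h * z)%g = f z.
  move=> Hh; rewrite /f; congr supR; apply: pred_ext => r; split=> [[k [Hk ->]]|[k [Hk ->]]].
    exists (h^-1 * k)%g; split; first by apply: subgroupM => //; apply: subgroupV.
    by rewrite -(dS_actV h) mulKg.
  by exists (h * k)%g; split; [apply: subgroupM|rewrite dS_act].
exists (retr G d f); split; first by apply: retr_inEX => //; [exact: dSxx|exact: dSC].
move=> h Hh z; rewrite {1}/act; apply: (retr_equiv G d dSxx dSC f (fun z => h^-1 * z)%g) => //.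
- by move=> x y; apply: dS_act.
- by move=> y; exists (h * y)%g; rewrite mulKg.
- by move=> x; apply: fH; apply: subgroupV.
Qed.

(** Convex combinations keep [H]-invariance and so does [retr], so the contraction stays among the
    fixed points. *)
Lemma contractible_fixE (H : G -> Prop) : subgroup H -> finite_set H -> contractible (fixE S H).
Proof.
move=> Hs Hf; have [c [cE cH]] := fixE_inhabited H Hs Hf.
apply: (contractible_inEX G d dSxx dSC dS_tri _ c) => //; first by move=> f [].
- move=> t f t01 [fE fH].
  have gD : inDelta d (fun x => (1 - t) * f x + t * c x).
    by apply: inDelta_convex (proj1 fE) (proj1 cE).
  split; first by apply: retr_inEX => //; [exact: dSxx|exact: dSC].
  move=> h Hh z; rewrite {1}/act; apply: (retr_equiv G d dSxx dSC _ (fun z => h^-1 * z)%g) => //.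
  - by move=> x y; apply: dS_act.
  - by move=> y; exists (h * y)%g; rewrite mulKg.
  - by move=> x; rewrite -/(act h f x) -/(act h c x) fH // cH.
- by constructor; apply: 1%g.
Qed.

(** * Simplex stabilizers, compactness and dimension from finitely many coordinates *)

Section Coordinates.
Hypothesis Hfc : forall M o, exists Z : seq G, forall z, exists z', List.In z' Z /\
  forall f, inEX d f -> f o <= M -> f z - d z o = f z' - d z' o.

(* [x] permutes the finite chain of the relations [Aof d b] strictly monotonically, hence
   fixes them, hence fixes the cells they determine and the barycenters of these. *)
Lemma act_fix_simplex x sigma : subdiv_simplex d sigma -> act_img x sigma = sigma ->
  forall f, sigma f -> act x f = f.
Proof.
move=> [cs [bs [_ [csC [chain [csbs sE]]]]]]; rewrite (pred_ext _ _ _ sE) => xs.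
have [bs_s /List.Forall_forall bsP] := simplex_chain G d dSxx dSC Hfc cs bs csC chain csbs.
have bsD : List.Forall (inDelta d) bs by apply/List.Forall_forall => b /bsP [].
have fixA : forall A, List.In A [seq Aof d b | b <- bs] ->
    (fun u v => A (x^-1 * u)%g (x^-1 * v)%g) = A.
  apply: (monotone_chain_fix _ (rel_lt G) _ _ _ _ _ bs_s).
  - exact: rel_lt_irr.
  - exact: rel_lt_trans.
  - exact: act_rel_lt.
  move=> _ /List.in_map_iff [b [<- bbs]].
  (* [act x b] lies in the preserved simplex, so its tight relation is that of some barycenter in
     [bs]. *)
  have [|b' [b'bs e]] := conv_hull_Aof G d bs (act x b) bs_s bsD.
    by rewrite -xs act_imgE actK; apply: conv_hull_mem.
  by rewrite -Aof_act e; apply: (List.in_map (Aof d)).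
have fixb b : List.In b bs -> act x b = b.
  move=> bbs; have [_ [_ bb]] := bsP b bbs.
  apply: (barycenter_unique G _ _ _ _ bb).
  have := act_is_barycenter x _ _ bb.
  by rewrite act_img_Pcell Aof_act (fixA _ (List.in_map (Aof d) bs b bbs)).
move=> f [ts [_ [_ [_ fE]]]]; apply: functional_extensionality => z.
rewrite /act !fE.
elim: (ts) {fE bs_s bsP bsD fixA xs sE csbs chain} (bs) fixb => [|t ts' IH] [|b bs'] //= fixb.
rewrite IH; last by move=> b' h; apply: fixb; right.
by rewrite -[b in LHS]/(b) -{2}(fixb b (or_introl erefl)).
Qed.

Lemma seq_compact_inEX_le M : seq_compact (fun f => inEX d f /\ f 1%g <= M).
Proof.
have [Z hZ] := Hfc M 1%g.
apply: (fin_coord_seq_compact G _ Z).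
- move=> z; have [z' [z'Z h]] := hZ z; exists z', (d z 1%g - d z' 1%g); split=> // f [fE fM].
  by have := h f fE fM; lra.
- move=> z; exists (M + d z 1%g) => f [fE fM].
  have := inEX_lip G d dSxx dSC dS_tri f z 1%g fE.
  have := inDelta_ge0 G d dSxx f z (proj1 fE) => f0.
  by rewrite Rabs_pos_eq //; lra.
- move=> f fl; split.
    by apply: inEX_closed => [||eps /fl [g [[gE _] gf]]]; [exact: dSxx|exact: dSC|exists g].
  apply: le_epsilon => eps /fl [g [[_ gM] gf]].
  by move: (gf 1%g) => /Rabs_le_inv; lra.
Qed.

Lemma affdim_act x C n : affdim_le (act_img x C) n -> affdim_le C n.
Proof.
move=> [p [us [usn h]]]; exists (act x^-1%g p), [seq act x^-1%g u | u <- us].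
split=> [|g Cg]; first by rewrite size_map.
have [|cs [csn gE]] := h (act x g); first by rewrite act_imgE actK.
exists cs; split=> // z; have := gE (x * z)%g; rewrite {1}/act mulKg => ->.
rewrite {1}/act invgK; congr (_ + _).
by elim: (cs) (us) => [|t ts IH] [|u us'] //=; rewrite IH /act invgK.
Qed.

(** Translation by [v^-1] brings the small value to the identity, where [cell_affdim] bounds the
    dimension of all cells at once. *)
Lemma finite_dimensional M : (forall f, inEX d f -> exists v, f v <= M) ->
  exists n, forall C, is_cell d C -> affdim_le C n.
Proof.
move=> near; have [n hn] := cell_affdim G d dSxx Hfc M 1%g.
exists n => C /is_cellP [f [fE [fc ->]]]; have [v fv] := near f fE.
apply: (affdim_act v^-1%g); rewrite act_img_Pcell; apply: hn; first exact: act_inEX.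
  move=> y; rewrite Aof_act invgK; have [z yz] := fc (v * y)%g.
  by exists (v^-1 * z)%g; rewrite mulVKg.
by rewrite /act invgK mulg1.
Qed.

End Coordinates.
End Action.

(** * Proper action, classifying space and cocompactness *)

Theorem theorem1p4 (G : groupType) (S : seq G) :
  generates S ->
  forall beta : R, 0 <= beta -> stable_intervals (dS S) beta ->
  (* Gamma acts on E(Gamma_S) by (x,f) |-> f o L_x^{-1} ... *)
  ((forall f z, act (1 : G)%g f z = f z) /\
   (forall (x y : G) f z, act (x * y)%g f z = act x (act y f) z) /\
   (forall (x : G) f, inEX (dS S) f -> inEX (dS S) (act x f)) /\
   (* ... by isometries ... *)
   (forall (x : G) f g r, inEX (dS S) f -> inEX (dS S) g ->
      (dist_le (act x f) (act x g) r <-> dist_le f g r)) /\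
   (* ... which are cellular ... *)
   (forall (x : G) C, is_cell (dS S) C -> is_cell (dS S) (act_img x C)) /\
   (* ... and the action is proper *)
   (forall f, inEX (dS S) f -> exists r, 0 < r /\ exists l : seq G,
      forall x : G, (exists g, inEX (dS S) g /\ dist_lt f g r /\ dist_lt f (act x g) r) ->
        x \in l) /\
   (* the first barycentric subdivision is a Gamma-CW complex
      (simplicial action, stabilizers of simplices fix them pointwise) ... *)
   (forall (x : G) sigma, subdiv_simplex (dS S) sigma ->
      subdiv_simplex (dS S) (act_img x sigma) /\
      ((forall g, act_img x sigma g <-> sigma g) ->
         forall f, sigma f -> forall z, act x f z = f z)) /\
   (* ... which is a model for the classifying space for proper actions *)
   (forall H : G -> Prop, subgroup H ->
      (finite_set H -> contractible (fixE S H)) /\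
      (~ finite_set H -> forall f, ~ fixE S H f)))
  /\
  (forall delta : R, 0 <= delta -> hyperbolic (dS S) delta ->
     (* E(Gamma_S) is finite dimensional ... *)
     (exists n : nat, forall C, is_cell (dS S) C -> affdim_le C n) /\
     (* ... and the action is cocompact *)
     (exists K, seq_compact K /\ (forall f, K f -> inEX (dS S) f) /\
        forall f, inEX (dS S) f -> exists (x : G) g, K g /\ forall z, f z = act x g z)).

Proof.
move=> Sgen beta beta0 stab.
have dI x y : dS S x y = INR (wdist G S x y) by [].
(* A natural number above [beta] serves as the stability constant for integer distances. *)
have [b hb] := INR_unbounded beta.
have Dst x y y' v : wdist G S y y' = 1%nat -> (wdist G S x v + wdist G S v y = wdist G S x y)%nat ->
    exists u, (wdist G S x u + wdist G S u y' = wdist G S x y')%nat /\ (wdist G S v u <= b)%nat.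
  move=> yy' vI; have [|h _] := stab x y y'; first by rewrite dI yy'.
  have [|u [uI vu]] := h v; first by rewrite /intervalX !dI -vI plus_INR.
  exists u; split; last by apply: INR_leq; rewrite -dI; lra.
  by apply: INR_eq; rewrite plus_INR -!dI.
have Hfc := extremal_fin_coord G (wdist G S) b (wdistxx G S Sgen) (wdistC G S Sgen)
  (wdist_tri G S Sgen) (wdist_geo G S Sgen) (wdist_ball G S Sgen) Dst.
split; last first.
  move=> delta delta0 hyp.
  have near f : inEX (dS S) f -> exists v, f v <= delta + 2.
    exact: (hyperbolic_near G (wdist G S) (wdistxx G S Sgen) (wdistC G S Sgen)
      (wdist_tri G S Sgen) (wdist_geo G S Sgen) delta f 1%g hyp).
  split; first exact: (finite_dimensional G S Sgen Hfc _ near).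
  (* By [near], some translate of each extremal function is at most [delta + 2] at 1, so translates
     of this set cover the hull. *)
  exists (fun f => inEX (dS S) f /\ f 1%g <= delta + 2).
  split; first exact: seq_compact_inEX_le.
  split=> [f [] //|f fE]; have [v fv] := near f fE.
  exists v, (act v^-1%g f); split; last by move=> z; rewrite actVK.
  by split; [exact: act_inEX|rewrite /act invgK mulg1].
split; first by move=> f z; rewrite act1.
split; first by move=> x y f z; rewrite actM.
split; first exact: act_inEX.
split.
  move=> x f g r _ _; split=> h z; last exact: h.
  by have := h (x * z)%g; rewrite /act mulKg.
split; first exact: act_is_cell.
split.
  move=> f fE; exists 1; split; first lra.
  have [l hl] := act_proper G S Sgen f; exists l => x /hl; apply; exact: (proj1 fE).
split.
  move=> x sigma sS; split; first exact: act_subdiv_simplex.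
  by move=> /pred_ext xs f sf z; rewrite (act_fix_simplex G S Sgen Hfc x sigma sS xs f sf).
move=> H Hs; split=> [Hf|nH f Hf]; first exact: contractible_fixE.
exact: nH (finite_fixed_point G S Sgen H f Hf).
Qed.
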